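(* Let $T_1,T_2:M\to\mathcal{A}$ be two $\mathcal{O}$-operators on an associative conformal algebra $\mathcal{A}$ with respect to a conformal $\mathcal{A}$-bimodule $M$. If $T_1$ and $T_2$ are invertible, then $T_1$ and $T_2$ are compatible if and only if $N=T_1T_2^{-1}$ is a Nijenhuis operator on the associative conformal algebra $\mathcal{A}$.
   Context: All vector spaces are over $\mathbb{C}$. For $\mathbb{C}[\partial]$-modules $U,V,W$, a $\mathbb{C}$-bilinear map $U\times V\to W[\lambda]$, $(u,v)\mapsto u_\lambda v$, is conformal sesquilinear if $(\partial u)_\lambda v=-\lambda\, u_\lambda v$ and $u_\lambda(\partial v)=(\partial+\lambda)(u_\lambda v)$. Maps are extended coefficientwise to polynomials. An associative conformal algebra is a $\mathbb{C}[\partial]$-module $\mathcal{A}$ with a conformal sesquilinear map $(a,b)\mapsto a_\lambda b\in\mathcal{A}[\lambda]$ with $(a_\lambda b)_{\lambda+\mu}c=a_\lambda(b_\mu c)$. A conformal $\mathcal{A}$-bimodule is a $\mathbb{C}[\partial]$-module $M$ with conformal sesquilinear maps $(a,m)\mapsto a_\lambda m\in M[\lambda]$ and $(m,a)\mapsto m_\lambda a\in M[\lambda]$ such that $(a_\lambda b)_{\lambda+\mu}m=a_\lambda(b_\mu m)$, $(m_\lambda a)_{\lambda+\mu}b=m_\lambda(a_\mu b)$, $(a_\lambda m)_{\lambda+\mu}b=a_\lambda(m_\mu b)$. An $\mathcal{O}$-operator on $\mathcal{A}$ with respect to $M$ is a $\mathbb{C}[\partial]$-module homomorphism $T:M\to\mathcal{A}$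 with $T(m)_\lambda T(n)=T(T(m)_\lambda n+m_\lambda T(n))$ for all $m,n\in M$. Two $\mathcal{O}$-operators $T_1,T_2$ are compatible if $T_1+T_2$ is again an $\mathcal{O}$-operator. A Nijenhuis operator on $\mathcal{A}$ is a $\mathbb{C}[\partial]$-module homomorphism $N:\mathcal{A}\to\mathcal{A}$ with $N(a)_\lambda N(b)=N\big(N(a)_\lambda b+a_\lambda N(b)-N(a_\lambda b)\big)$ for all $a,b\in\mathcal{A}$. *)

(* Defs.v *)
From mathcomp Require Import all_boot all_algebra.
From mathcomp Require Import reals complex.
From mathcomp Require Import finmap monalg.

Set Implicit Arguments.
Unset Strict Implicit.
Unset Printing Implicit Defensive.

Import GRing.Theory.
Local Open Scope ring_scope.

(* A K[d]-module is an lmodType over {poly K}: the operator d is the scaling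
   by 'X, and c in K acts as c%:P.
   W[lambda] is {malg W[nat]}, the finitely supported functions nat -> W:
   <<w *g k>> is lambda^k w and u@_k is the coefficient of lambda^k in u.
   W[lambda, mu] is {malg W[nat * nat]}, with <<w *g (i, j)>> for
   lambda^i mu^j w. *)

Section Polynomials.
Variables V W : zmodType.
Implicit Type u : {malg V[nat]}.

(* The coefficientwise extension of f (meant for f additive). *)
Definition mapc (f : V -> W) u : {malg W[nat]} :=
  \sum_(k <- msupp u) << f u@_k *g k >>.

Definition mul_lambda u : {malg V[nat]} :=
  \sum_(k <- msupp u) << u@_k *g k.+1 >>.

(* u(lambda + mu), by the binomial expansion of (lambda + mu)^k. *)
Definition subst_add u : {malg V[(nat * nat)%type]} :=
  \sum_(k <- msupp u) \sum_(i < k.+1)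
    << u@_k *+ 'C(k, i) *g ((i : nat), (k - i)%N) >>.

(* lambda^i u(lambda, mu) *)
Definition mulX_lambda (i : nat) (u : {malg V[(nat * nat)%type]}) :
    {malg V[(nat * nat)%type]} :=
  \sum_(k <- msupp u) << u@_k *g ((i + k.1)%N, k.2) >>.

End Polynomials.

Section NestedProducts.
Variables X Y Z W : zmodType.

(* For u = \sum_i lambda^i u_i in X[lambda], the element
   u_{lambda + mu} z = \sum_i lambda^i (u_i)_{lambda + mu} z. *)
Definition nestl (p : X -> Z -> {malg W[nat]}) (u : {malg X[nat]}) (z : Z) :
    {malg W[(nat * nat)%type]} :=
  \sum_(i <- msupp u) mulX_lambda i (subst_add (p u@_i z)).

(* For v = \sum_j mu^j v_j in Y[mu], the element
   x_lambda v = \sum_j mu^j (x_lambda v_j). *)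
Definition nestr (q : X -> Y -> {malg W[nat]}) (x : X) (v : {malg Y[nat]}) :
    {malg W[(nat * nat)%type]} :=
  \sum_(j <- msupp v) \sum_(i <- msupp (q x v@_j)) << (q x v@_j)@_i *g (i, j) >>.

End NestedProducts.

(* (x_lambda y)_{lambda + mu} z = x_lambda (y_mu z) *)
Definition conformal_assoc (X Y Z XY YZ W : zmodType)
    (p1 : X -> Y -> {malg XY[nat]}) (p2 : XY -> Z -> {malg W[nat]})
    (q1 : Y -> Z -> {malg YZ[nat]}) (q2 : X -> YZ -> {malg W[nat]}) : Prop :=
  forall x y z, nestl p2 (p1 x y) z = nestr q2 x (q1 y z).

Section ConformalModules.
Variable K : fieldType.

Record conformal_sesquilinear (U V W : lmodType {poly K})
    (p : U -> V -> {malg W[nat]}) : Prop := ConformalSesquilinear {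
  csl_linearl : forall (c : K) u1 u2 v,
    p (c%:P *: u1 + u2) v = mapc (fun w => c%:P *: w) (p u1 v) + p u2 v;
  csl_linearr : forall (c : K) u v1 v2,
    p u (c%:P *: v1 + v2) = mapc (fun w => c%:P *: w) (p u v1) + p u v2;
  csl_derl : forall u v, p ('X *: u) v = - mul_lambda (p u v);
  csl_derr : forall u v,
    p u ('X *: v) = mapc (fun w => 'X *: w) (p u v) + mul_lambda (p u v) }.

Record assoc_conformal (A : lmodType {poly K}) := AssocConformal {
  lprod : A -> A -> {malg A[nat]};
  lprod_sesquilinear : conformal_sesquilinear lprod;
  lprod_assoc : conformal_assoc lprod lprod lprod lprod }.

Record conformal_bimodule (A : lmodType {poly K}) (sA : assoc_conformal A)
    (M : lmodType {poly K}) := ConformalBimodule {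
  lact : A -> M -> {malg M[nat]};
  ract : M -> A -> {malg M[nat]};
  lact_sesquilinear : conformal_sesquilinear lact;
  ract_sesquilinear : conformal_sesquilinear ract;
  lact_assoc : conformal_assoc (lprod sA) lact lact lact;
  ract_assoc : conformal_assoc ract ract (lprod sA) ract;
  lract_assoc : conformal_assoc lact ract ract lact }.

Section Operators.
Variables (A : lmodType {poly K}) (sA : assoc_conformal A).
Variables (M : lmodType {poly K}) (sM : conformal_bimodule sA M).

Record O_operator (T : M -> A) : Prop := OOperator {
  O_operator_linear : linear T;
  O_operatorE : forall m n : M,
    lprod sA (T m) (T n) = mapc T (lact sM (T m) n + ract sM m (T n)) }.

Definition compatible (T1 T2 : M -> A) : Prop := O_operator (T1 \+ T2).

Record Nijenhuis_operator (N : A -> A) : Prop := NijenhuisOperator {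
  Nijenhuis_linear : linear N;
  NijenhuisE : forall a b : A,
    lprod sA (N a) (N b) =
    mapc N (lprod sA (N a) b + lprod sA a (N b) - mapc N (lprod sA a b)) }.

End Operators.

End ConformalModules.

(* Main.v *)
(** Both conditions are equivalent to equality of the mixed terms
    T1 m . T2 n + T2 m . T1 n = T1 (T2 m . n + m . T2 n) + T2 (T1 m . n + m . T1 n).
    For compatibility this is what remains of the O-operator identity for
    T1 + T2 after cancelling those for T1 and T2. For N = T1 T2^-1, put
    a = T2 m and b = T2 n: the Nijenhuis identity is then N applied to the
    mixed identity, and N is injective. *)

Require Import Defs.
From mathcomp Require Import all_boot all_algebra.
From mathcomp Require Import reals complex.
From mathcomp Require Import finmap monalg.

Set Implicit Arguments.
Unset Strict Implicit.
Unset Printing Implicit Defensive.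

Import GRing.Theory.
Local Open Scope ring_scope.

Section CoefficientwiseExtension.
Variables V W : zmodType.

(** The sum in [mapc] runs over the support of [u] only; at every other index the coefficient is 0,
    and [f 0 = 0] closes the gap. With this, identities between values of [mapc] are checked one
    coefficient at a time. *)
Lemma mcoeff_mapc (f : V -> W) (u : {malg V[nat]}) k :
  f 0 = 0 -> (mapc f u)@_k = f u@_k.
Proof.
move=> f0; rewrite /mapc raddf_sum /=.
under eq_bigr do rewrite mcoeffU.
have [uk|uk] := boolP (k \in msupp u).
  rewrite (big_fsetD1 k) //= eqxx big1_fset ?addr0 // => j.
  by rewrite in_fsetD1 => /andP[/negbTE->].
rewrite (mcoeff_outdom uk) f0 big1_fset // => j uj _.
by case: eqP uj uk => // -> ->.
Qed.

Lemma mapcD (f : V -> W) : f 0 = 0 -> {morph f : x y / x + y} ->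
  {morph mapc f : u v / u + v}.
Proof.
by move=> f0 fD u v; apply/malgP=> k; rewrite !(mcoeffD, mcoeff_mapc).
Qed.

Lemma mapc_inj (f : V -> W) : f 0 = 0 -> injective f -> injective (mapc f).
Proof.
move=> f0 f_inj u v /malgP uv; apply/malgP=> k; apply: f_inj.
by have := uv k; rewrite !mcoeff_mapc.
Qed.

Lemma mapc_add (f g : V -> W) (u : {malg V[nat]}) : f 0 = 0 -> g 0 = 0 ->
  mapc (f \+ g) u = mapc f u + mapc g u.
Proof.
move=> f0 g0; apply/malgP=> k.
by rewrite mcoeffD !mcoeff_mapc //= f0 g0 addr0.
Qed.

End CoefficientwiseExtension.

Lemma mapc_comp (U V W : zmodType) (f : V -> W) (g : U -> V)
    (u : {malg U[nat]}) :
  f 0 = 0 -> g 0 = 0 -> mapc (f \o g) u = mapc f (mapc g u).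
Proof.
by move=> f0 g0; apply/malgP=> k; rewrite !mcoeff_mapc //= g0.
Qed.

Section LinearMaps.
Variables (R : pzRingType) (U V : lmodType R) (f : U -> V).
Hypothesis f_lin : linear f.

Lemma linear_morphD : {morph f : x y / x + y}.
Proof. by move=> x y; have := f_lin 1 x y; rewrite !scale1r. Qed.

Lemma linear_morph0 : f 0 = 0.
Proof. by apply: (addrI (f 0)); rewrite -linear_morphD !addr0. Qed.

Lemma can_linear (g : V -> U) : cancel f g -> cancel g f -> linear g.
Proof. by move=> fK gK a x y; apply: (can_inj fK); rewrite f_lin !gK. Qed.

End LinearMaps.

Section ConformalSesquilinear.
Variables (K : fieldType) (U V W : lmodType {poly K}).
Variable p : U -> V -> {malg W[nat]}.
Hypothesis p_csl : conformal_sesquilinear p.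

(** Additivity in each argument is the case c = 1 of the linearity clauses, once the coefficientwise
    scaling by 1 is removed. *)
Let mapc_scale1 (u : {malg W[nat]}) : mapc (fun w => 1%:P *: w) u = u.
Proof. by apply/malgP=> k; rewrite mcoeff_mapc ?scaler0 ?scale1r. Qed.

Lemma csl_addl u1 u2 v : p (u1 + u2) v = p u1 v + p u2 v.
Proof.
by have := csl_linearl p_csl 1 u1 u2 v; rewrite mapc_scale1 scale1r.
Qed.

Lemma csl_addr u v1 v2 : p u (v1 + v2) = p u v1 + p u v2.
Proof.
by have := csl_linearr p_csl 1 u v1 v2; rewrite mapc_scale1 scale1r.
Qed.

End ConformalSesquilinear.

Section Compatibility.
Variables (K : fieldType) (A : lmodType {poly K}) (sA : assoc_conformal A).
Variables (M : lmodType {poly K}) (sM : conformal_bimodule sA M).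
Variables T1 T2 : M -> A.
Hypotheses (hT1 : O_operator sM T1) (hT2 : O_operator sM T2).

(** This is the product on M for which an O-operator T is multiplicative into A. *)
Definition induced_product (T : M -> A) (m n : M) : {malg M[nat]} :=
  lact sM (T m) n + ract sM m (T n).

Lemma compatible_iff_cross_terms :
  compatible sM T1 T2 <->
  forall m n, lprod sA (T1 m) (T2 n) + lprod sA (T2 m) (T1 n) =
    mapc T1 (induced_product T2 m n) + mapc T2 (induced_product T1 m n).
Proof.
have [T1l T1E] := hT1; have [T2l T2E] := hT2.
have [T10 T20] := (linear_morph0 T1l, linear_morph0 T2l).
(* The two sides of the identity for T1 + T2 are each split into a diagonal and a mixed part. The
   O-operator identities for T1 and T2 give both the same diagonal part, so it cancels by
   [addrI]. *)
have lhsE m n : lprod sA ((T1 \+ T2) m) ((T1 \+ T2) n) =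
    mapc T1 (induced_product T1 m n) + mapc T2 (induced_product T2 m n) +
    (lprod sA (T1 m) (T2 n) + lprod sA (T2 m) (T1 n)).
  rewrite /= (csl_addl (lprod_sesquilinear sA)).
  rewrite !(csl_addr (lprod_sesquilinear sA)) T1E T2E.
  by rewrite addrA -!addrA; congr (_ + _); rewrite !addrA addrC !addrA.
have rhsE m n :
    mapc (T1 \+ T2) (induced_product (T1 \+ T2) m n) =
    mapc T1 (induced_product T1 m n) + mapc T2 (induced_product T2 m n) +
    (mapc T1 (induced_product T2 m n) + mapc T2 (induced_product T1 m n)).
  (* For fixed m and n the induced product is additive in T, because both actions are biadditive. *)
  have -> : induced_product (T1 \+ T2) m n =
      induced_product T1 m n + induced_product T2 m n.
    rewrite /induced_product /= (csl_addl (lact_sesquilinear sM)).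
    by rewrite (csl_addr (ract_sesquilinear sM)) addrACA.
  rewrite mapc_add // (mapcD T10 (linear_morphD T1l)).
  rewrite (mapcD T20 (linear_morphD T2l)) [mapc T2 _ + _]addrC.
  by rewrite addrACA.
split=> [[_ TE] m n | crossE].
  have := TE m n; rewrite -/(induced_product (T1 \+ T2) m n) lhsE rhsE.
  exact: addrI.
split=> [a x y | m n]; first by rewrite /= T1l T2l scalerDr addrACA.
by rewrite -/(induced_product (T1 \+ T2) m n) lhsE rhsE crossE.
Qed.

Lemma Nijenhuis_iff_cross_terms (T2inv : A -> M) :
    injective T1 -> cancel T2 T2inv -> cancel T2inv T2 ->
  Nijenhuis_operator sA (T1 \o T2inv) <->
  forall m n, lprod sA (T1 m) (T2 n) + lprod sA (T2 m) (T1 n) =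
    mapc T1 (induced_product T2 m n) + mapc T2 (induced_product T1 m n).
Proof.
move=> T1_inj T2K T2invK.
have [T1l T1E] := hT1; have [T2l T2E] := hT2.
have [T10 T20] := (linear_morph0 T1l, linear_morph0 T2l).
set N := T1 \o T2inv.
have NT2 m : N (T2 m) = T1 m by rewrite /N /= T2K.
have Nl : linear N.
  by move=> a x y; rewrite /N /= (can_linear T2l T2K T2invK) T1l.
have N0 := linear_morph0 Nl.
have mapcN_inj : injective (mapc N).
  exact: mapc_inj N0 (inj_comp T1_inj (can_inj T2invK)).
have mapcNT2 u : mapc N (mapc T2 u) = mapc T1 u.
  by apply/malgP=> k; rewrite -mapc_comp // !mcoeff_mapc //= NT2.
(* Since N T2 = T1, the O-operator identity for T1 exhibits the left side of the Nijenhuis identity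
   as a value of [mapc N], as the right side already is. *)
have NE m n : lprod sA (N (T2 m)) (N (T2 n)) =
    mapc N (mapc T2 (induced_product T1 m n)).
  by rewrite mapcNT2 -T1E !NT2.
have NprodE m n :
    mapc N (lprod sA (T2 m) (T2 n)) = mapc T1 (induced_product T2 m n).
  by rewrite T2E mapcNT2.
split=> [[_ NN] m n | crossE].
  (* Cancelling N leaves the mixed identity solved for [mapc T2 (induced_product T1 m n)]. *)
  have := NN (T2 m) (T2 n); rewrite NE NprodE => /mapcN_inj ->.
  by rewrite -!NT2 /= [RHS]addrC subrK.
(* T2 is onto, so a and b may be taken as T2 m and T2 n; the mixed identity then equates the
   arguments of [mapc N]. *)
split=> // a b; rewrite -[a]T2invK -[b]T2invK NE NprodE.
move: (T2inv a) (T2inv b) => m n; congr (mapc N _).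
by rewrite /N /= !T2K crossE addrAC subrr add0r.
Qed.

End Compatibility.

Theorem theorem5p15 (R : realType)
    (A : lmodType {poly R[i]}) (sA : assoc_conformal A)
    (M : lmodType {poly R[i]}) (sM : conformal_bimodule sA M)
    (T1 T2 : M -> A) (T2inv : A -> M)
    (hT1 : O_operator sM T1) (hT2 : O_operator sM T2)
    (bijT1 : bijective T1)
    (T2K : cancel T2 T2inv) (T2invK : cancel T2inv T2) :
  compatible sM T1 T2 <-> Nijenhuis_operator sA (T1 \o T2inv).
Proof.
apply: (iff_trans (compatible_iff_cross_terms hT1 hT2)); apply: iff_sym.
exact: Nijenhuis_iff_cross_terms hT1 hT2 _ (bij_inj bijT1) T2K T2invK.
Qed.
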